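(* Let $\Gamma=(V,E)$ be a connected finite simple graph on $N\geq 3$ vertices, and let $\varepsilon:=\min_i|1-\lambda_i|$, where $\lambda_1,\dots,\lambda_N$ are the eigenvalues of its normalized Laplacian. Then $\varepsilon\leq \frac12$. Moreover, $\varepsilon=\frac12$ if and only if $\Gamma$ is an $m$-petal graph for some $m\geq 1$ (this requires $N=2m+1$ odd) or an $m$-book graph for some $m\geq1$ (this requires $N=2m+2$ even).
   Context: For a finite simple graph $\Gamma=(V,E)$ without isolated vertices, $\deg v$ is the number of neighbours of $v$ and $\mathcal N(v)=\{w\in V: w\sim v\}$. The normalized Laplacian acts on functions $f:V\to\mathbb R$ by $\Delta f(v)=f(v)-\frac{1}{\deg v}\sum_{w\sim v}f(w)$; its eigenvalues are $0=\lambda_1\le\lambda_2\le\dots\le\lambda_N$, and $\varepsilon:=\min_i|1-\lambda_i|$. The $m$-petal graph ($m\ge1$) has vertex set $\{x,v_1,\dots,v_m,w_1,\dots,w_m\}$ and edges $\{x,v_i\},\{x,w_i\},\{v_i,w_i\}$ for $i=1,\dots,m$. The $m$-book graph ($m\ge1$) has vertex set $\{x,y,v_1,\dots,v_m,w_1,\dots,w_m\}$ and edges $\{x,v_i\},\{y,w_i\},\{v_i,w_i\}$ for $i=1,\dots,m$. *)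

(* Defs.v *)
From HB Require Import structures.
From mathcomp Require Import all_boot all_order all_algebra.
From mathcomp Require Import reals.
Set Implicit Arguments. Unset Strict Implicit. Unset Printing Implicit Defensive.
Import Order.TTheory GRing.Theory Num.Theory.
Local Open Scope ring_scope.

Definition simple_graph (n : nat) (e : rel 'I_n) : Prop :=
  (forall u v, e u v = e v u) /\ (forall v, ~~ e v v).

Definition connected_graph (n : nat) (e : rel 'I_n) : Prop :=
  forall u v, connect e u v.

Definition deg (n : nat) (e : rel 'I_n) (v : 'I_n) : nat := #|[set w | e v w]|.

Definition norm_laplacian (R : realType) (n : nat) (e : rel 'I_n) : 'M[R]_n :=
  \matrix_(i, j) ((i == j)%:R - (e i j)%:R / (deg e i)%:R).

Definition is_eps (R : realType) (n : nat) (e : rel 'I_n) (eps : R) : Prop :=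
  (exists2 l : R, eigenvalue (norm_laplacian R e) l & eps = `|1 - l|) /\
  (forall l : R, eigenvalue (norm_laplacian R e) l -> eps <= `|1 - l|).

Definition graph_iso (T T' : finType) (e : rel T) (e' : rel T') : Prop :=
  exists f : T -> T', bijective f /\ forall a b, e' (f a) (f b) = e a b.

(* m-petal graph: None = x, Some (inl i) = v_i, Some (inr i) = w_i. *)
Definition petal_adj (m : nat) : rel (option ('I_m + 'I_m)) :=
  fun a b => match a, b with
  | None, Some _ | Some _, None => true
  | Some (inl i), Some (inr j) | Some (inr i), Some (inl j) => i == j
  | _, _ => false
  end.

(* m-book graph: inl true = x, inl false = y, inr (inl i) = v_i, inr (inr i) = w_i. *)
Definition book_adj (m : nat) : rel (bool + ('I_m + 'I_m)) :=
  fun a b => match a, b with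
  | inl true, inr (inl _) | inr (inl _), inl true => true
  | inl false, inr (inr _) | inr (inr _), inl false => true
  | inr (inl i), inr (inr j) | inr (inr i), inr (inl j) => i == j
  | _, _ => false
  end.

(* Main.v *)
Require Import Defs.
From HB Require Import structures.
From mathcomp Require Import all_boot all_order all_algebra.
From mathcomp Require Import reals spectral sesquilinear complex polyrcf ring lra zify.
Import Order.TTheory GRing.Theory Num.Theory.
Set Implicit Arguments. Unset Strict Implicit. Unset Printing Implicit Defensive.
Local Open Scope ring_scope.

(** If every eigenvalue satisfies |1 - l| >= 1/2, the spectral theorem makes
    B = 4 A D^-1 A - D positive semidefinite, A being the adjacency and D the
    degree matrix. Its off-diagonal entries are 4 c(u,v), where c(u,v) sums 1/deg
    over the common neighbours, and its diagonal entries h(v) are large only if v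
    has many neighbours of degree at most 3. Leaves and their neighbours can be
    deleted without changing the degree weights; if nothing is left, the minors of
    B force the path on four vertices, a book with one page. Otherwise the 2 x 2
    minors force two adjacent vertices x, a of degree 2. Let b and c be their
    other neighbours. The minors at {a,b} and {x,c} give
    deg b >= h(b) >= deg c >= h(c) >= deg b, so all of these are equal and both
    minors vanish. The rows of B at a and b are then proportional, which pairs the
    neighbours of b with those of c: a petal graph if b = c, a book otherwise.
    Conversely, the eigenvalue equations of petals and books solve explicitly. *)

(** * Symmetric matrices with eigenvalues away from zero *)

Section Spectral.
Local Open Scope sesquilinear_scope.
Local Open Scope complex_scope.

Lemma mulmx_adj_norm (C : numClosedFieldType) n (h : 'rV[C]_n) :
  (h *m h ^t*) 0 0 = \sum_i `|h 0 i| ^+ 2.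
Proof. by rewrite mxE; apply: eq_bigr => i _; rewrite !mxE normCK. Qed.

(** In an orthonormal eigenbasis [M] multiplies each coordinate of [g] by an eigenvalue, and unitary
    changes of basis preserve norms. [M] is complexified to use the hermitian spectral
    decomposition. *)
Lemma symmetric_eigenvalue_bound (R : rcfType) n (M : 'M[R]_n) (a : R) :
  M^T = M -> 0 <= a -> (forall l, eigenvalue M l -> a <= `|l|) ->
  forall g : 'rV_n, a ^+ 2 * \sum_i g 0 i ^+ 2 <= \sum_i (g *m M) 0 i ^+ 2.
Proof.
move=> Msym a_ge0 Meig g.
pose A : 'M[R[i]]_n := map_mx (real_complex R) M.
pose P := spectralmx A; pose sp := spectral_diag A.
have Aherm : A \is hermsymmx.
  apply: realsym_hermsym; first by apply/is_hermitianmxP;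
    rewrite expr0 scale1r map_mx_id // /A map_trmx Msym.
  by apply/mxOverP => i j; rewrite mxE complex_real.
have /orthomx_spectralP A_eq := hermitian_normalmx Aherm.
have Pun : P \is unitarymx := spectral_unitarymx A.
have Pu : P \in unitmx := spectral_unit A.
have PA : P *m A = diag_mx sp *m P by rewrite A_eq !mulmxA mulmxV // mul1mx.
have sp_ge i : (a%:C) <= `|sp 0 i|.
  have /mxOverP /(_ 0 i) /complex_realP [r rE] := hermitian_spectral_diag_real Aherm.
  rewrite -/sp in rE; rewrite rE normc_def /= expr0n addr0 sqrtr_sqr lecR.
  apply: Meig; rewrite -(eigenvalue_map (real_complex R)) -/A -[_ r]rE.
  apply/eigenvalueP; exists (row i P).
    by rewrite -row_mul PA mul_diag_mx; apply/rowP => j; rewrite !mxE.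
  apply: contraTneq isT => /(congr1 (mulmx^~ (invmx P))).
  rewrite -row_mul mulmxV // mul0mx => /rowP /(_ i).
  by rewrite !mxE eqxx => /eqP; rewrite oner_eq0.
pose g' := map_mx (real_complex R) g.
pose h := g' *m P ^t*.
have hE : (h *m h ^t*) 0 0 = (\sum_i g 0 i ^+ 2)%:C.
  rewrite /h trmx_mul map_mxM trmxCK mulmxA mulmxKtV //.
  rewrite mulmx_adj_norm rmorph_sum; apply: eq_bigr => i _.
  by rewrite mxE normc_def /= expr0n addr0 sqrtr_sqr -rmorphXn /= real_normK ?num_real.
have gA : g' *m A = h *m diag_mx sp *m P.
  by rewrite A_eq invmx_unitary // !mulmxA.
have kE : ((h *m diag_mx sp) *m (h *m diag_mx sp) ^t*) 0 0
    = (\sum_i (g *m M) 0 i ^+ 2)%:C.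
  transitivity (((g' *m A) *m (g' *m A) ^t*) 0 0).
    rewrite gA; set k := h *m _.
    by rewrite (trmx_mul k) map_mxM mulmxA mulmxtVK.
  rewrite -map_mxM mulmx_adj_norm rmorph_sum; apply: eq_bigr => i _.
  by rewrite mxE normc_def /= expr0n addr0 sqrtr_sqr -rmorphXn /= real_normK ?num_real.
rewrite -lecR -kE {gA kE} rmorphM /= -hE !mulmx_adj_norm mulr_sumr.
clearbody h; apply: ler_sum => i _; rewrite mul_mx_diag mxE normrM exprMn mulrC.
apply: ler_wpM2l; first exact: exprn_ge0.
by rewrite rmorphXn /= lerXn2r // ?nnegrE ?normr_ge0 ?lecR.
Qed.
End Spectral.

(** * The quadratic form *)

(* For [W = setT] this is the variational form of [1 / 2 <= `|1 - l|] for all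
   eigenvalues [l]; for smaller [W] the degrees are still those of the whole graph. *)
Definition gap_on (R : realFieldType) n (e : rel 'I_n) (W : {set 'I_n}) :=
  forall f : 'I_n -> R,
  \sum_(v in W) (deg e v)%:R * f v ^+ 2 <=
  4 * \sum_(v in W) (\sum_(w in W) (e v w)%:R * f w) ^+ 2 / (deg e v)%:R.

(* A book has [page_shape e b c] and [page_shape e c b] for its two centres; a
   petal graph is the degenerate case [b = c]. *)
Definition page_shape n (e : rel 'I_n) b c := forall x, e b x ->
  exists2 z, e c z & [set w | e x w] = [set b; z].

Section QuadraticForm.
Context {R : realFieldType} {n : nat} {e : rel 'I_n}.
Context (e_sym : forall u v, e u v = e v u) (e_irr : forall v, ~~ e v v).
Context (deg_gt0 : forall v, (0 < deg e v)%N).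
Implicit Types (u v w x y z : 'I_n) (W : {set 'I_n}).

Local Notation D v := ((deg e v)%:R : R).

(* [4 * codeg W u v] off the diagonal and [excess W v] on it are the entries of
   the matrix 4 A D^-1 A - D on W, whose positive semidefiniteness is [gap_on]. *)
Definition codeg W u v : R := \sum_(y in W) (e y u)%:R * (e y v)%:R / D y.

Definition excess W v : R := 4 * codeg W v v - D v.

Lemma excessE W v : excess W v = 4 * codeg W v v - D v.
Proof. by []. Qed.

Lemma D_gt0 v : 0 < D v. Proof. by rewrite ltr0n. Qed.
Lemma Dinv_gt0 v : 0 < (D v)^-1. Proof. by rewrite invr_gt0 D_gt0. Qed.

Lemma codeg_term_ge0 u v y : 0 <= (e y u)%:R * (e y v)%:R / D y.
Proof. by rewrite !mulr_ge0 ?ler0n // ltW ?Dinv_gt0. Qed.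

Lemma codeg_ge W u v y : y \in W -> e y u -> e y v -> (D y)^-1 <= codeg W u v.
Proof.
move=> yW eyu eyv; rewrite /codeg (bigD1 y) //= eyu eyv !mul1r lerDl.
by apply: sumr_ge0 => z _; exact: codeg_term_ge0.
Qed.

Lemma codeg_ge2 W u v y z : y != z -> y \in W -> e y u -> e y v ->
  z \in W -> e z u -> e z v -> (D y)^-1 + (D z)^-1 <= codeg W u v.
Proof.
move=> yz yW eyu eyv zW ezu ezv.
rewrite /codeg (bigD1 y) //= eyu eyv !mul1r lerD2l.
rewrite (bigD1 z) /=; last by rewrite zW eq_sym.
rewrite ezu ezv !mul1r lerDl.
by apply: sumr_ge0 => t _; exact: codeg_term_ge0.
Qed.

Lemma codeg_gt0 W u v :
  0 < codeg W u v -> exists y, [/\ y \in W, e y u & e y v].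
Proof.
move=> cgt0.
have [/existsP [y /and3P [yW eyu eyv]]|] :=
  boolP [exists y, [&& y \in W, e y u & e y v]]; first by exists y.
move=> /existsPn none; move: cgt0; rewrite /codeg big1 ?ltxx // => y yW.
move: (none y); rewrite yW /=.
by case: (e y u) => /=; [case: (e y v) => //= _; rewrite mulr0 mul0r|rewrite !mul0r].
Qed.

Lemma sum_nbr_const v (t : R) : \sum_(y | e v y) t = D v * t.
Proof. by rewrite sumr_const mulr_natl /deg cardsE. Qed.

Lemma codeg_diag_le W v (t : 'I_n -> R) :
  (forall y, e v y -> 0 <= t y) ->
  (forall y, y \in W -> e v y -> (D y)^-1 <= t y) ->
  codeg W v v <= \sum_(y | e v y) t y.
Proof.
move=> t0 tW; rewrite /codeg big_mkcond [leRHS]big_mkcond /=.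
apply: ler_sum => y _; rewrite (e_sym y v).
case: ifP => yW; case: ifP => evy //; rewrite ?mul1r ?mul0r //; first exact: tW.
exact: t0.
Qed.

Lemma codeg_diag_le1 W v (t : R) : 0 <= t ->
  (forall y, y \in W -> e v y -> (D y)^-1 <= t) -> codeg W v v <= D v * t.
Proof. by move=> t0 tW; rewrite -sum_nbr_const; apply: codeg_diag_le. Qed.

Lemma codeg_diag_le2 W v u (r t : R) : e v u -> 0 <= r -> 0 <= t ->
  (u \in W -> (D u)^-1 <= r) ->
  (forall y, y \in W -> e v y -> y != u -> (D y)^-1 <= t) ->
  codeg W v v <= r + (D v - 1) * t.
Proof.
move=> evu r0 t0 uW tW.
have -> : r + (D v - 1) * t = \sum_(y | e v y) (if y == u then r else t).
  rewrite (bigD1 u) //= eqxx; congr (_ + _).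
  rewrite mulrBl mul1r -sum_nbr_const [in LHS](bigD1 u) //= addrAC subrr add0r.
  by apply: eq_bigr => y /andP [_ /negbTE ->].
apply: codeg_diag_le => y; first by case: ifP.
by move=> yW evy; case: eqP => [yu|/eqP yu]; [rewrite yu in yW *; exact: uW|exact: tW].
Qed.

Lemma codeg_diag_pair W v a b (r s : R) : [set w | e v w] = [set a; b] -> a != b ->
  0 <= r -> 0 <= s ->
  (a \in W -> (D a)^-1 <= r) -> (b \in W -> (D b)^-1 <= s) ->
  codeg W v v <= r + s.
Proof.
move=> Nv ab r0 s0 aW bW.
have evE y : e v y = (y \in [set a; b]) by rewrite -Nv inE.
have -> : r + s = \sum_(y | e v y) (if y == a then r else s).
  rewrite (eq_bigl _ _ evE) big_setU1 ?inE //= big_set1 eqxx.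
  by rewrite eq_sym (negbTE ab).
apply: codeg_diag_le => y; first by case: ifP.
rewrite evE !inE => yW; case: eqP => [ya _|_ /= /eqP yb].
  by rewrite ya in yW *; exact: aW.
by rewrite yb in yW *; exact: bW.
Qed.

(** The form is evaluated at a combination of three indicator functions. The guard on [c] lets [w]
    coincide with [u] when [c = 0], which yields the two-variable case. *)
Lemma gap_on_quad3 W u v w (a b c : R) : gap_on R e W ->
  u \in W -> v \in W -> w \in W -> u != v ->
  (c != 0 -> (w != u) && (w != v)) ->
  0 <= a ^+ 2 * excess W u + b ^+ 2 * excess W v + c ^+ 2 * excess W w
     + 8 * (a * b * codeg W u v + a * c * codeg W u w + b * c * codeg W v w).
Proof.
move=> gap uW vW wW uv cw.
have delta_sum x (g : 'I_n -> R) : x \in W -> \sum_(y in W) (y == x)%:R * g y = g x.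
  move=> xW; rewrite (bigD1 x) //= eqxx mul1r big1 ?addr0 // => y /andP [_ /negbTE ->].
  by rewrite mul0r.
pose f x := a * (x == u)%:R + b * (x == v)%:R + c * (x == w)%:R : R.
have lhsE : \sum_(x in W) D x * f x ^+ 2
    = a ^+ 2 * D u + b ^+ 2 * D v + c ^+ 2 * D w.
  rewrite -(delta_sum u (fun x => D x)) // -(delta_sum v (fun x => D x)) //.
  rewrite -(delta_sum w (fun x => D x)) // !mulr_sumr -!big_split /=.
  apply: eq_bigr => x _; rewrite /f.
  have [c0|/cw /andP [wu wv]] := eqVneq c 0.
    rewrite c0; case: eqP => [->|_]; first by rewrite (negbTE uv) /=; ring.
    by case: eqP => _ /=; ring.
  case: eqP => [->|_]; first by rewrite (negbTE uv) eq_sym (negbTE wu) /=; ring.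
  case: eqP => [->|_]; first by rewrite eq_sym (negbTE wv) /=; ring.
  by case: eqP => _ /=; ring.
have rhsE : \sum_(x in W) (\sum_(y in W) (e x y)%:R * f y) ^+ 2 / D x
   = a ^+ 2 * codeg W u u + b ^+ 2 * codeg W v v + c ^+ 2 * codeg W w w
     + 2 * (a * b * codeg W u v + a * c * codeg W u w + b * c * codeg W v w).
  rewrite /codeg !mulr_sumr -!big_split /= mulr_sumr -big_split /=.
  apply: eq_bigr => x _.
  have -> : \sum_(y in W) (e x y)%:R * f y
      = a * (e x u)%:R + b * (e x v)%:R + c * (e x w)%:R.
    rewrite -(delta_sum u (fun y => (e x y)%:R)) // -(delta_sum v (fun y => (e x y)%:R)) //.
    rewrite -(delta_sum w (fun y => (e x y)%:R)) // !mulr_sumr -!big_split /=.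
    by apply: eq_bigr => y _; rewrite /f; ring.
  by ring.
by move: (gap f); rewrite lhsE rhsE /excess -subr_ge0; congr (_ <= _); ring.
Qed.

Lemma gap_on_quad2 W u v (a b : R) : gap_on R e W -> u \in W -> v \in W -> u != v ->
  0 <= a ^+ 2 * excess W u + b ^+ 2 * excess W v + 8 * (a * b * codeg W u v).
Proof.
move=> gap uW vW uv.
have c0 : (0 : R) != 0 -> (u != u) && (u != v) by rewrite eqxx.
have := @gap_on_quad3 W u v u a b 0 gap uW vW uW uv c0.
by congr (_ <= _); ring.
Qed.

Lemma excess_ge0 W v : gap_on R e W -> v \in W -> 0 <= excess W v.
Proof.
move=> gap vW; have := gap (fun x => (x == v)%:R).
rewrite (bigD1 v) //= eqxx expr1n mulr1 big1; last first.
  by move=> x /andP [_ /negbTE ->]; rewrite expr0n mulr0.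
rewrite addr0 /excess subr_ge0 /codeg; congr (_ <= 4 * _).
apply: eq_bigr => y _; congr (_ / _); rewrite (bigD1 v) //= eqxx mulr1 big1.
  by rewrite addr0 expr2.
by move=> x /andP [_ /negbTE ->]; rewrite mulr0.
Qed.

Lemma codeg_minor W u v : gap_on R e W -> u \in W -> v \in W -> u != v ->
  16 * codeg W u v ^+ 2 <= excess W u * excess W v.
Proof.
move=> gap uW vW uv.
have hu := excess_ge0 gap uW; have hv := excess_ge0 gap vW.
have Q a b := @gap_on_quad2 W u v a b gap uW vW uv.
move: (excess W u) (excess W v) (codeg W u v) hu hv Q => hu hv c hu0 hv0 Q.
have [hu1|hu1] := eqVneq hu 0.
  (* If [hu] vanishes, the form takes the value -16 c^2 (hv + 2) at this vector, which forces c =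
     0. *)
  by have := Q (- (hv + 1)) (4 * c); rewrite hu1; nra.
have {hu0 hu1} hu0 : 0 < hu by rewrite lt0r hu1.
(* This vector minimizes the form for fixed second coordinate; its value there is [hu] times the 2 x
   2 minor. *)
have := Q (- (4 * c)) hu.
have -> : (- (4 * c)) ^+ 2 * hu + hu ^+ 2 * hv + 8 * (- (4 * c) * hu * c)
  = hu * (hu * hv - 16 * c ^+ 2) by ring.
by rewrite pmulr_rge0 // subr_ge0.
Qed.

(* A vanishing 2 x 2 minor gives a null vector of the positive semidefinite
   form, so the two rows involved are proportional. *)
Lemma codeg_tight W u v w : gap_on R e W -> u \in W -> v \in W -> w \in W ->
  u != v -> w != u -> w != v ->
  excess W u * excess W v = 16 * codeg W u v ^+ 2 ->
  excess W v * codeg W u w = 4 * codeg W u v * codeg W v w.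
Proof.
move=> gap uW vW wW uv wu wv tight.
have hw := excess_ge0 gap wW.
have wuv : (w != u) && (w != v) by rewrite wu wv.
have Q a b c := @gap_on_quad3 W u v w a b c gap uW vW wW uv (fun=> wuv).
move: (excess W u) (excess W v) (excess W w) (codeg W u v) (codeg W u w)
  (codeg W v w) hw tight Q => hu hv hw cuv cuw cvw hw0 tight Q.
set k := hv * cuw - 4 * cuv * cvw.
(* The null vector (hv, -4 cuv) is perturbed by [c] in direction [w]. Nonnegativity for every [c]
   kills the linear coefficient [k]. *)
have key c : 0 <= c ^+ 2 * hw + 8 * c * k.
  have := Q hv (- (4 * cuv)) c; rewrite /k.
  have -> : hv ^+ 2 * hu + (- (4 * cuv)) ^+ 2 * hv + c ^+ 2 * hw
     + 8 * (hv * - (4 * cuv) * cuv + hv * c * cuw + - (4 * cuv) * c * cvw)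
     = c ^+ 2 * hw + 8 * c * (hv * cuw - 4 * cuv * cvw)
       + hv * (hu * hv - 16 * cuv ^+ 2) by ring.
  by rewrite tight subrr mulr0 addr0.
apply/eqP; rewrite -subr_eq0 -/k; apply/eqP.
have hw1 : 0 < hw + 1 by lra.
(* The denominator is [hw + 1] because [hw] may be zero. *)
have := key (- k / (hw + 1)).
have -> : (- k / (hw + 1)) ^+ 2 * hw + 8 * (- k / (hw + 1)) * k
  = - (k ^+ 2 * ((7 * hw + 8) / (hw + 1) ^+ 2)) by field; rewrite gt_eqF.
rewrite oppr_ge0 pmulr_lle0; last by apply: divr_gt0; nra.
by move=> k2; apply/eqP; rewrite -sqrf_eq0 eq_le k2 sqr_ge0.
Qed.

Lemma Dinv_le v k : (0 < k)%N -> (k <= deg e v)%N -> (D v)^-1 <= k%:R^-1.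
Proof. by move=> k0 kd; rewrite lef_pV2 ?posrE ?ltr0n // ler_nat. Qed.

Lemma nbrs_of_deg2 w a b : deg e w = 2 -> e w a -> e w b -> a != b ->
  [set z | e w z] = [set a; b].
Proof.
move=> dw ewa ewb ab; apply/esym/eqP; rewrite eqEcard cards2 ab -/(deg e w) dw leqnn andbT.
by apply/subsetP => z; rewrite !inE => /orP [] /eqP ->.
Qed.

Lemma nbrs_pairE w a b : [set z | e w z] = [set a; b] ->
  forall z, e w z = (z == a) || (z == b).
Proof. by move=> Nw z; move/setP: Nw => /(_ z); rewrite !inE. Qed.

(** * Vertex sets with degrees at least two and positive excess *)

Section Positive.
Context {W : {set 'I_n}} (gap : gap_on R e W).
Context (deg_ge2 : forall v, v \in W -> (2 <= deg e v)%N).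
Context (excess_gt0 : forall v, v \in W -> 0 < excess W v).

Lemma excess_le_deg v : excess W v <= D v.
Proof.
have : codeg W v v <= D v * 2^-1.
  by apply: codeg_diag_le1; rewrite ?invr_ge0 //; move=> y /deg_ge2 dy _; apply: Dinv_le.
by rewrite /excess; lra.
Qed.

(** A neighbour outside [W] would leave at most 1/2 in [codeg W x x], hence an excess of at most 4/2
    - 2 = 0. *)
Lemma nbrs_deg2 x : x \in W -> deg e x = 2 ->
  exists a b, [/\ a != b, [set w | e x w] = [set a; b], a \in W & b \in W].
Proof.
move=> xW dx; have /eqP/cards2P [a [b [ab Nx]]] := dx.
have half y : y \in W -> (D y)^-1 <= 2^-1 by move=> /deg_ge2; exact: Dinv_le.
suff inW a' b' : a' != b' -> [set w | e x w] = [set a'; b'] -> a' \in W.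
  by exists a, b; split=> //; [exact: inW Nx|apply: (inW b a); rewrite 1?eq_sym // setUC].
move=> ab' Nx'; apply: contraT => aW; have := excess_gt0 xW.
have : codeg W x x <= 0 + 2^-1.
  apply: (codeg_diag_pair Nx' ab' (lexx 0) _ _ (half b')).
    by rewrite invr_ge0.
  by rewrite (negbTE aW).
by rewrite /excess dx; lra.
Qed.

Lemma codeg_nbrs x a b : x \in W -> a \in W -> b \in W -> e x a -> e x b ->
  a != b -> 16 * (D x)^-1 ^+ 2 <= excess W a * excess W b.
Proof.
move=> xW aW bW exa exb ab; apply: le_trans (codeg_minor gap aW bW ab).
by rewrite ler_wpM2l // lerXn2r ?nnegrE ?(ltW (Dinv_gt0 _)) ?codeg_ge //;
  apply: le_trans (codeg_ge xW exa exb); rewrite ltW ?Dinv_gt0.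
Qed.

(** A vertex [x] of least degree in [W] is taken. Least degree 4 or more makes its excess
    nonpositive. If it is 3, some neighbour has degree 3 and excess at most 1, and the minors push
    the degrees of the others too high. *)
Lemma exists_deg2 v0 : v0 \in W -> exists2 x, x \in W & deg e x = 2.
Proof.
move=> v0W; case: (@arg_minnP _ v0 [in W] (deg e) v0W) => x xW xmin.
have [d2|d2] := eqVneq (deg e x) 2; first by exists x.
have d3 : (3 <= deg e x)%N by rewrite ltn_neqAle eq_sym d2 deg_ge2.
have bound3 y : excess W y <= D y / 3.
  have : codeg W y y <= D y * 3^-1.
    apply: codeg_diag_le1; rewrite ?invr_ge0 //; move=> z zW _.
    by apply: Dinv_le => //; apply: leq_trans (xmin z zW).
  by rewrite /excess; lra.
have big_contra k : (4 <= k)%N ->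
    ~ (forall y, y \in W -> e x y -> (k <= deg e y)%N).
  move=> k4 all4; have := excess_gt0 xW.
  have : codeg W x x <= D x * 4^-1.
    apply: codeg_diag_le1; rewrite ?invr_ge0 //; move=> y yW exy.
    by apply: Dinv_le => //; exact: leq_trans (all4 y _ _).
  by rewrite /excess; lra.
have {}d3 : deg e x = 3.
  apply/eqP; rewrite eqn_leq d3 andbT leqNgt; apply/negP => d4.
  by apply: (big_contra _ d4) => y yW _; exact: xmin.
have [u uW /andP [exu du]] : exists2 u, u \in W & e x u && (deg e u == 3).
  apply/exists_inP; apply: contraT => /exists_inPn none.
  case: (big_contra 4 isT) => y yW exy; have := none y yW.
  by have := xmin y yW; rewrite d3 exy /=; lia.
have hu : excess W u <= 1 by have := bound3 u; rewrite (eqP du); lra.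
have hx := excess_gt0 xW.
(* The minor at [u] and [y] gives [excess W y >= 16 / 9], so [D y >= 16 / 3]. The total 4 (1/3 + 2 *
   3/16) = 17/6 is below 3. *)
have : codeg W x x <= 3^-1 + (D x - 1) * (3 / 16).
  apply: (codeg_diag_le2 exu); rewrite ?invr_ge0 //.
  - by lra.
  - by rewrite (eqP du).
  - move=> y yW exy yu; have := codeg_nbrs xW uW yW exu exy.
    rewrite eq_sym => /(_ yu); rewrite d3 => min_uy.
    have hy : 16 / 9 <= excess W y.
      have := excess_gt0 yW; have := excess_gt0 uW; nra.
    have Dy : 16 / 3 <= D y by have := bound3 y; lra.
    rewrite -[3 / 16]invrK lef_pV2 ?posrE ?D_gt0 ?invr_gt0 //; last by lra.
    by rewrite invf_div.
by move: hx; rewrite /excess d3; lra.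
Qed.

Lemma deg2_adj_bound x a (t : R) : x \in W -> deg e x = 2 -> e x a -> 0 <= t ->
  (forall y, y \in W -> e a y -> y != x -> (D y)^-1 <= t) ->
  excess W a <= 4 * (2^-1 + (D a - 1) * t) - D a.
Proof.
move=> xW dx exa t0 ht; rewrite /excess lerD2r ler_wpM2l //.
by apply: codeg_diag_le2 ht => //; rewrite ?invr_ge0 // ?dx // e_sym.
Qed.


Lemma deg3_far_nbr x a y : x \in W -> a \in W -> y \in W -> deg e a = 3 ->
  e x a -> e a y -> y != x -> 16 / 9 <= excess W x * D y.
Proof.
move=> xW aW yW da exa eay yx.
have eax : e a x by rewrite e_sym.
have := codeg_nbrs aW xW yW eax eay; rewrite eq_sym => /(_ yx); rewrite da.
by have := excess_gt0 xW; have := excess_le_deg y; nra.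
Qed.

(** In [codeg W a a] the vertex [x] contributes 1/2, and each of the two other neighbours at most 9
    s / 16 by [deg3_far_nbr]. *)
Lemma deg3_nbr_bound x a (s : R) : x \in W -> a \in W -> deg e x = 2 ->
  deg e a = 3 -> e x a -> excess W x <= s -> excess W a <= 9 / 2 * s - 1.
Proof.
move=> xW aW dx da exa hs; have hx := excess_gt0 xW.
have : excess W a <= 4 * (2^-1 + (D a - 1) * (9 / 16 * s)) - D a.
  apply: (deg2_adj_bound xW dx exa); first by lra.
  move=> y yW eay yx; have := deg3_far_nbr xW aW yW da exa eay yx => hy.
  have Dy := D_gt0 y.
  by rewrite -[leRHS]divr1 ler_pdivlMr // ler_pdivrMl //; nra.
by rewrite da; lra.
Qed.

(** For [s = 2 / 3] the general bound gives only 2, and a product 2 * 2 would not contradict a minor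
    of size 4. Since degrees are integers, [D y >= 8 / 3] improves to 3. *)
Lemma deg3_nbr_bound3 x a : x \in W -> a \in W -> deg e x = 2 ->
  deg e a = 3 -> e x a -> excess W x <= 2 / 3 -> excess W a <= 5 / 3.
Proof.
move=> xW aW dx da exa hs.
have : excess W a <= 4 * (2^-1 + (D a - 1) * 3^-1) - D a.
  apply: (deg2_adj_bound xW dx exa); first by rewrite invr_ge0.
  move=> y yW eay yx; have hy := deg3_far_nbr xW aW yW da exa eay yx.
  apply: Dinv_le => //; rewrite ltnNge; apply/negP => dy.
  have : D y <= 2 by rewrite ler_nat.
  have := excess_gt0 xW; have := D_gt0 y; nra.
by rewrite da; lra.
Qed.

(** The minor at [a] and [b] asks for an excess product of at least 4, and positivity at [x] leaves
    3, 4, 5 for the degree of [b]. The product is at most 25/9 for 3 and 2 for 4; for 5 the excess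
    of [a] is negative. *)
Lemma deg2_no_deg3 x a b : x \in W -> a \in W -> b \in W -> a != b ->
  deg e x = 2 -> [set w | e x w] = [set a; b] ->
  deg e a = 3 -> (3 <= deg e b)%N -> False.
Proof.
move=> xW aW bW ab dx Nx da db.
have exa : e x a by rewrite (nbrs_pairE Nx) eqxx.
have exb : e x b by rewrite (nbrs_pairE Nx) eqxx orbT.
have hx := excess_gt0 xW.
have hxle : excess W x <= 4 * (D b)^-1 - 2 / 3.
  have : codeg W x x <= 3^-1 + (D b)^-1.
    by apply: (codeg_diag_pair Nx ab) => //; rewrite ?invr_ge0 ?da.
  by rewrite /excess dx; lra.
have := codeg_nbrs xW aW bW exa exb ab; rewrite dx => min_ab.
have ha := excess_gt0 aW; have hb := excess_gt0 bW; have hbD := excess_le_deg b.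
have db6 : (deg e b < 6)%N.
  rewrite ltnNge; apply/negP => db6.
  by have : (D b)^-1 <= 6^-1 by [exact: Dinv_le]; lra.
move: db db6; rewrite leq_eqVlt => /orP [/eqP db3 _|].
  have hx3 : excess W x <= 2 / 3 by rewrite -db3 in hxle; lra.
  have := deg3_nbr_bound3 xW aW dx da exa hx3.
  have := deg3_nbr_bound3 xW bW dx (esym db3) exb hx3.
  by nra.
rewrite leq_eqVlt => /orP [/eqP db4 _|].
  rewrite -db4 in hxle hbD.
  have hx4 : excess W x <= 3^-1 by lra.
  by have := deg3_nbr_bound xW aW dx da exa hx4; nra.
move=> db4 db6; have db5 : deg e b = 5 by lia.
rewrite db5 in hxle.
have hx5 : excess W x <= 2 / 15 by lra.
by have := deg3_nbr_bound xW aW dx da exa hx5; lra.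
Qed.

Lemma deg2_has_deg2_nbr x : x \in W -> deg e x = 2 ->
  exists2 a, a \in W & e x a /\ deg e a = 2.
Proof.
move=> xW dx; have [a [b [ab Nx aW bW]]] := nbrs_deg2 xW dx.
have exa : e x a by rewrite (nbrs_pairE Nx) eqxx.
have exb : e x b by rewrite (nbrs_pairE Nx) eqxx orbT.
have [da|da] := eqVneq (deg e a) 2; first by exists a.
have [db|db] := eqVneq (deg e b) 2; first by exists b.
have da3 : (3 <= deg e a)%N by rewrite ltn_neqAle eq_sym da deg_ge2.
have db3 : (3 <= deg e b)%N by rewrite ltn_neqAle eq_sym db deg_ge2.
have [da4|/eqP da4] := eqVneq (deg e a) 3.
  by case: (deg2_no_deg3 xW aW bW ab dx Nx da4 db3).
have [db4|/eqP db4] := eqVneq (deg e b) 3.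
  case: (deg2_no_deg3 xW bW aW _ dx _ db4 da3); first by rewrite eq_sym.
  by rewrite setUC.
have : codeg W x x <= 4^-1 + 4^-1.
  by apply: (codeg_diag_pair Nx ab); rewrite ?invr_ge0 // => _; apply: Dinv_le; lia.
by have := excess_gt0 xW; rewrite /excess dx; lra.
Qed.

(** Equality case of [excess_le_deg]: a single neighbour outside [W] or of degree at least 3 costs
    at least 2/3. *)
Lemma excess_eq_deg v : excess W v = D v ->
  forall y, e v y -> y \in W /\ deg e y = 2.
Proof.
move=> hv y evy; suff /andP [yW /eqP dy] : (y \in W) && (deg e y == 2) by [].
apply: contraT => nice.
have : codeg W v v <= 3^-1 + (D v - 1) * 2^-1.
  apply: (codeg_diag_le2 evy); rewrite ?invr_ge0 //.
    move=> yW; move: nice; rewrite yW /= => dy; apply: Dinv_le => //.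
    by rewrite ltn_neqAle eq_sym dy deg_ge2.
  by move=> z zW _ _; apply: Dinv_le => //; exact: deg_ge2.
by move: hv; rewrite /excess; lra.
Qed.

Lemma deg2_edge x a b c : x \in W -> a \in W -> b \in W -> c \in W ->
  deg e x = 2 -> deg e a = 2 -> a != b -> x != c ->
  [set w | e x w] = [set a; b] -> [set w | e a w] = [set x; c] ->
  [/\ excess W b = D b, excess W a * excess W b = 4 & codeg W a b = 2^-1].
Proof.
move=> xW aW bW cW dx da ab xc Nx Na.
have exa : e x a by rewrite (nbrs_pairE Nx) eqxx.
have exb : e x b by rewrite (nbrs_pairE Nx) eqxx orbT.
have eax : e a x by rewrite (nbrs_pairE Na) eqxx.
have eac : e a c by rewrite (nbrs_pairE Na) eqxx orbT.
have half v w u y : [set z | e v z] = [set w; u] -> w != u -> deg e v = 2 ->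
    deg e w = 2 -> excess W v <= 4 / D u.
  move=> Nv wu dv dw.
  have : codeg W v v <= 2^-1 + (D u)^-1.
    by apply: (codeg_diag_pair Nv wu); rewrite ?invr_ge0 ?dw.
  by rewrite /excess dv; lra.
have hx := half _ _ _ x Nx ab dx da; have ha := half _ _ _ x Na xc da dx.
have mab : 16 * codeg W a b ^+ 2 <= excess W a * excess W b := codeg_minor gap aW bW ab.
have mxc := codeg_minor gap xW cW xc.
have cab : 2^-1 <= codeg W a b by have := codeg_ge xW exa exb; rewrite dx.
have cxc : 2^-1 <= codeg W x c by have := codeg_ge aW eax eac; rewrite da.
have hb := excess_le_deg b; have hc := excess_le_deg c.
have hb0 := excess_gt0 bW; have hc0 := excess_gt0 cW.
rewrite ler_pdivlMr ?D_gt0 // in hx; rewrite ler_pdivlMr ?D_gt0 // in ha.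
have ha0 := excess_gt0 aW; have hx0 := excess_gt0 xW.
have pab : 4 <= excess W a * excess W b by nra.
have pxc : 4 <= excess W x * excess W c by nra.
(* By [ha], [excess W a * D c] is at most 4, hence at most [excess W a * excess W b]; the positive
   factor cancels. The next line does the same at [x]. *)
have cb : D c <= excess W b by nra.
have bc : D b <= excess W c by nra.
have pab4 : excess W a * excess W b = 4 by apply/eqP; rewrite eq_le pab andbT; nra.
split=> //; first by lra.
by apply/eqP; rewrite eq_le cab andbT; nra.
Qed.

(** For a neighbour [w] of [c], the tight minor at [a] and [b] turns the common neighbour [c] of [a]
    and [w] into a common neighbour [z] of [b] and [w]. Non-adjacency of [b] and [c] keeps [z]
    different from [c]. The case [b = c] is covered too. *)
Lemma deg2_edge_page x a b c : x \in W -> a \in W -> b \in W -> c \in W ->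
  deg e x = 2 -> deg e a = 2 -> a != b -> x != c ->
  [set w | e x w] = [set a; b] -> [set w | e a w] = [set x; c] ->
  ~~ e b c -> page_shape e c b.
Proof.
move=> xW aW bW cW dx da ab xc Nx Na nbc w ecw.
have [hb pab cab] := deg2_edge xW aW bW cW dx da ab xc Nx Na.
have [hc _ _] := deg2_edge aW xW cW bW da dx xc ab Na Nx.
have exb : e x b by rewrite (nbrs_pairE Nx) eqxx orbT.
have eac : e a c by rewrite (nbrs_pairE Na) eqxx orbT.
have [wa|wa] := eqVneq w a; first by exists x; rewrite 1?e_sym // wa setUC.
have wb : w != b by apply: contraNneq nbc => <-; rewrite e_sym.
have [wW dw] := excess_eq_deg hc ecw.
have tight : excess W a * excess W b = 16 * codeg W a b ^+ 2.
  by rewrite pab cab; field.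
have caw : 0 < codeg W a w.
  by apply: lt_le_trans (Dinv_gt0 c) (codeg_ge cW _ ecw); rewrite e_sym.
have := codeg_tight gap aW bW wW ab wa wb tight; rewrite cab => prop.
have [|z [zW ezb ezw]] := @codeg_gt0 W b w.
  by have := excess_gt0 bW; nra.
have ebz : e b z by rewrite e_sym.
exists z => //; apply: nbrs_of_deg2; rewrite 1?e_sym //.
by apply: contraNneq nbc => ->.
Qed.

Lemma positive_shape v0 : v0 \in W ->
  (exists b, page_shape e b b) \/
  (exists b c, [/\ b != c, ~~ e b c, page_shape e b c & page_shape e c b]).
Proof.
move=> v0W; have [x xW dx] := exists_deg2 v0W.
have [a aW [exa da]] := deg2_has_deg2_nbr xW dx.
have other v w : v \in W -> deg e v = 2 -> e v w ->
    exists2 u, u \in W & w != u /\ [set z | e v z] = [set w; u].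
  move=> vW dv evw; have [p [q [pq Nv pW qW]]] := nbrs_deg2 vW dv.
  move: evw; rewrite (nbrs_pairE Nv) => /orP [] /eqP ->; first by exists q.
  by exists p => //; rewrite eq_sym setUC.
have [b bW [ab Nx]] := other _ _ xW dx exa.
have eax : e a x by rewrite e_sym.
have [c cW [xc Na]] := other _ _ aW da eax.
have [bc|bc] := eqVneq b c.
  left; exists b; rewrite -bc in xc Na.
  by apply: (deg2_edge_page xW aW bW bW dx da ab xc Nx Na).
right; exists b, c; have nbc : ~~ e b c; last first.
  have ncb : ~~ e c b by rewrite e_sym.
  split=> //.
    exact: (deg2_edge_page aW xW cW bW da dx xc ab Na Nx).
  exact: (deg2_edge_page xW aW bW cW dx da ab xc Nx Na).
(* Otherwise [c] would be a second common neighbour of [a] and [b] besides [x], pushing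
   [codeg W a b] above 1/2. *)
apply/negP => ebc.
have [_ _ cab] := deg2_edge xW aW bW cW dx da ab xc Nx Na.
have exb : e x b by rewrite (nbrs_pairE Nx) eqxx orbT.
have eca : e c a by rewrite e_sym (nbrs_pairE Na) eqxx orbT.
have := codeg_ge2 xc xW exa exb cW eca _; rewrite e_sym ebc cab dx => /(_ isT).
by have := Dinv_gt0 c; lra.
Qed.

End Positive.

End QuadraticForm.

(** * From the spectrum to the quadratic form *)

Lemma sum_setT (V : nmodType) (T : finType) (F : T -> V) :
  \sum_(i in setT) F i = \sum_i F i.
Proof. by apply: eq_bigl => i; rewrite inE. Qed.

(** [M] is D^(-1/2) A D^(-1/2), symmetric and similar to the identity minus the Laplacian. The
    spectral bound for [M] is applied to the vector [f i * s i]. *)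
Lemma gap_on_setT (R : realType) n (e : rel 'I_n) :
  (forall u v, e u v = e v u) -> (forall v, (0 < deg e v)%N) ->
  (forall l : R, eigenvalue (norm_laplacian R e) l -> 1 / 2 <= `|1 - l|) ->
  gap_on R e setT.
Proof.
move=> e_sym deg_gt0 Leig f.
pose s i : R := Num.sqrt (deg e i)%:R.
have sE i : s i ^+ 2 = (deg e i)%:R by rewrite sqr_sqrtr ?ler0n.
have s_gt0 i : 0 < s i by rewrite sqrtr_gt0 ltr0n.
have s_neq0 i : s i != 0 by rewrite gt_eqF.
pose M : 'M[R]_n := \matrix_(i, j) ((e i j)%:R / (s i * s j)).
have Msym : M^T = M by apply/matrixP => i j; rewrite !mxE e_sym [s i * _]mulrC.
have Meig l : eigenvalue M l -> 1 / 2 <= `|l|.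
  move=> /eigenvalueP [v /rowP vM v0]; have := Leig (1 - l); rewrite subKr; apply.
  apply/eigenvalueP.
  (* Eigenvectors are rows here, so the passage from [M] to the Laplacian multiplies by [s] instead
     of dividing. *)
  exists (\row_i (v 0 i * s i)); last first.
    apply: contra_neq v0 => /rowP v0; apply/rowP => i; have := v0 i.
    by rewrite !mxE => /eqP; rewrite mulf_eq0 (negbTE (s_neq0 i)) orbF => /eqP.
  apply/rowP => j; have := vM j; rewrite !mxE => vMj.
  have -> : (1 - l) * (v 0 j * s j) = v 0 j * s j - s j * (l * v 0 j) by ring.
  rewrite -vMj mulr_sumr -[v 0 j * s j in RHS]mulr1.
  under eq_bigr do rewrite !mxE mulrBr.
  rewrite sumrB (bigD1 j) //= eqxx big1 ?addr0.
    congr (_ - _); apply: eq_bigr => i _; rewrite !mxE -sE; field.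
    by rewrite !s_neq0.
  by move=> i /negbTE ->; rewrite mulr0.
have half_ge0 : 0 <= 1 / 2 :> R by rewrite divr_ge0.
have := symmetric_eigenvalue_bound Msym half_ge0 Meig (\row_i (f i * s i)).
have -> : \sum_i (\row_i (f i * s i)) 0 i ^+ 2
    = \sum_(v in setT) (deg e v)%:R * f v ^+ 2.
  rewrite sum_setT; apply: eq_bigr => i _; rewrite mxE -sE; ring.
have -> : \sum_i ((\row_i (f i * s i)) *m M) 0 i ^+ 2
    = \sum_(v in setT) (\sum_(w in setT) (e v w)%:R * f w) ^+ 2 / (deg e v)%:R.
  rewrite sum_setT; apply: eq_bigr => i _; rewrite sum_setT mxE -sE -exprVn -exprMn.
  congr (_ ^+ 2); rewrite mulr_suml; apply: eq_bigr => j _; rewrite !mxE e_sym.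
  by field; rewrite !s_neq0.
by lra.
Qed.

(** * Leaves *)

Lemma connected_closed n (e : rel 'I_n) (A : {set 'I_n}) a :
  connected_graph e -> a \in A ->
  (forall u v, u \in A -> e u v -> v \in A) -> A = setT.
Proof.
move=> conn aA clA; apply/setP => v; rewrite inE.
have /connectP [p] := conn a v.
elim: p a aA => [|b p IHp] a aA /=; first by move=> _ ->.
by move=> /andP [eab pb] vE; apply: (IHp b) => //; exact: clA eab.
Qed.

Section Leaves.
Context {R : realFieldType} {n : nat} {e : rel 'I_n}.
Context (e_sym : forall u v, e u v = e v u) (e_irr : forall v, ~~ e v v).
Context (conn : connected_graph e) (n_ge3 : (3 <= n)%N).
Context (gap : gap_on R e setT).
Implicit Types (u v w x y z l p : 'I_n) (W : {set 'I_n}).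

Local Notation D v := ((deg e v)%:R : R).
Local Notation codeg := (@codeg R n e).
Local Notation excess := (@excess R n e).

Lemma connected_card_ge3 (A : {set 'I_n}) a : a \in A -> (#|A| <= 2)%N ->
  (forall u v, u \in A -> e u v -> v \in A) -> False.
Proof.
move=> aA cA clA; move: cA; rewrite (connected_closed conn aA clA) cardsT card_ord.
by move/(leq_trans n_ge3).
Qed.

Lemma connected_deg_gt0 v : (0 < deg e v)%N.
Proof.
rewrite lt0n; apply/negP => /eqP/cards0_eq Nv.
apply: (@connected_card_ge3 [set v] v); rewrite ?inE ?cards1 //.
move=> u w; rewrite inE => /eqP -> evw.
by move/setP: Nv => /(_ w); rewrite !inE evw.
Qed.

Let deg_gt0 := connected_deg_gt0.

Lemma leaf_nbr l p : deg e l = 1%N -> e l p -> forall y, e l y = (y == p).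
Proof.
move=> /eqP/cards1P [q Nl] elp y.
have NlE z : e l z = (z == q) by move/setP: Nl => /(_ z); rewrite !inE.
by move: elp; rewrite !NlE => /eqP ->.
Qed.

Lemma support_deg_ge2 l p : deg e l = 1%N -> e l p -> (2 <= deg e p)%N.
Proof.
move=> dl elp; rewrite ltn_neqAle deg_gt0 andbT; apply/negP => /eqP /esym dp.
have epl : e p l by rewrite e_sym.
apply: (@connected_card_ge3 [set l; p] l); rewrite ?inE ?eqxx //.
  by rewrite cards2; case: (_ != _).
move=> u v; rewrite !inE => /orP [] /eqP ->.
  by rewrite (leaf_nbr dl elp) => ->; rewrite orbT.
by rewrite (leaf_nbr dp epl) => ->.
Qed.

Lemma leaf_excess_le l p : deg e l = 1%N -> e l p ->
  excess setT l <= 4 * (D p)^-1 - 1.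
Proof.
move=> dl elp; have : codeg setT l l <= D l * (D p)^-1.
  apply: codeg_diag_le1 => //; first by rewrite invr_ge0 ler0n.
  by move=> y _; rewrite (leaf_nbr dl elp) => /eqP ->.
by rewrite excessE dl; lra.
Qed.

Lemma leaf_minor l p y : deg e l = 1%N -> e l p -> e p y -> y != l ->
  16 * (D p)^-1 ^+ 2 <= (4 * (D p)^-1 - 1) * excess setT y.
Proof.
move=> dl elp epy yl; have epl : e p l by rewrite e_sym.
have yT : y \in [set: 'I_n] by rewrite inE.
have lT : l \in [set: 'I_n] by rewrite inE.
have pT : p \in [set: 'I_n] by rewrite inE.
have := codeg_minor gap yT lT yl; have cge := codeg_ge (R := R) deg_gt0 pT epy epl.
have hl := leaf_excess_le dl elp; have hy := excess_ge0 gap yT.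
have Dp := Dinv_gt0 (R := R) deg_gt0 p => minor.
rewrite [leRHS]mulrC; apply: le_trans (ler_wpM2l hy hl); apply: le_trans minor.
by rewrite ler_wpM2l // lerXn2r ?nnegrE ?(ltW Dp) // (le_trans _ cge) ?(ltW Dp).
Qed.

(** With t = 1 / deg p, two leaves at [p] would give 16 t^2 <= (4 t - 1)^2 although 4 t >= 1. *)
Lemma leaf_unique l l' p : deg e l = 1%N -> deg e l' = 1%N -> e l p -> e l' p ->
  l' = l.
Proof.
move=> dl dl' elp el'p; apply/eqP; apply: contraT => l'l.
have epl' : e p l' by rewrite e_sym.
have := leaf_minor dl elp epl' l'l; have := leaf_excess_le dl' el'p.
have lT : l' \in [set: 'I_n] by rewrite inE.
have := excess_ge0 gap lT; have := Dinv_gt0 (R := R) deg_gt0 p.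
by nra.
Qed.

Definition leaves := [set l | deg e l == 1%N].
Definition supports := [set p | [exists l in leaves, e p l]].
Definition core := ~: (leaves :|: supports).

Lemma core_deg_ge2 v : v \in core -> (2 <= deg e v)%N.
Proof.
by rewrite !inE negb_or => /andP [dv _]; rewrite ltn_neqAle eq_sym dv deg_gt0.
Qed.

Lemma core_nbr_not_leaf v w : v \in core -> e v w -> w \notin leaves.
Proof.
rewrite !inE negb_or => /andP [_ /exists_inPn none] evw; apply/negP => dw.
by have := none w; rewrite inE dw evw => /(_ isT).
Qed.

(* Extend f from the core by 0 on the supports and choose the value at each
   leaf so that the neighbour sums at the supports vanish. *)
Lemma gap_on_core : gap_on R e core.
Proof.
move=> f.
pose g v := \sum_(y in core) (e v y)%:R * f y : R.
(* At a leaf this sum has a single term, the value of [g] at its support, so no support has to be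
   chosen. *)
pose h l := \sum_p (e l p)%:R * g p : R.
pose F v := if v \in core then f v else if v \in leaves then - h v else 0.
have coreL v : v \in core -> v \in leaves = false.
  by rewrite inE in_setU negb_or => /andP [/negbTE].
have FE v : \sum_(w in setT) (e v w)%:R * F w
    = g v - \sum_(w in leaves) (e v w)%:R * h w.
  rewrite sum_setT /g [X in _ = X - _]big_mkcond [X in _ = _ - X]big_mkcond -sumrB.
  apply: eq_bigr => w _.
  rewrite /F; have [wc|_] := boolP (w \in core); first by rewrite (coreL w wc) subr0.
  by case: ifP => _; [rewrite sub0r mulrN|rewrite mulr0 subr0].
have F_core v : v \in core -> \sum_(w in setT) (e v w)%:R * F w = g v.
  move=> vc; rewrite FE big1 ?subr0 // => w wl.
  by case evw: (e v w); rewrite ?mul0r //; have := core_nbr_not_leaf vc evw; rewrite wl.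
(* At a leaf, the only neighbour is a support, where [F] is 0. At a support, the term of its unique
   leaf cancels [g]. *)
have F_out v : v \notin core -> \sum_(w in setT) (e v w)%:R * F w = 0.
  rewrite inE negbK in_setU FE => /orP [vl|].
    have dv : deg e v = 1%N by move: vl; rewrite inE => /eqP.
    rewrite /g !big1 ?subr0 // => w ws.
      case evw: (e v w); rewrite ?mul0r //.
      by move: ws; rewrite inE => /eqP dw; have := support_deg_ge2 dv evw; rewrite dw.
    case evw: (e v w); rewrite ?mul0r //.
    have ewv : e w v by rewrite e_sym.
    by have := core_nbr_not_leaf ws ewv; rewrite vl.
  rewrite inE => /exists_inP [l ll evl].
  have dl : deg e l = 1%N by move: ll; rewrite inE => /eqP.
  have elv : e l v by rewrite e_sym.
  rewrite (bigD1 l) //= evl mul1r big1 ?addr0.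
    rewrite /h (bigD1 v) //= elv mul1r big1 ?addr0 ?subrr // => p pv.
    by rewrite (leaf_nbr dl elv) (negbTE pv) mul0r.
  move=> w /andP [wl wl']; case evw: (e v w); rewrite ?mul0r //.
  have dw : deg e w = 1%N by move: wl; rewrite inE => /eqP.
  have ewv : e w v by rewrite e_sym.
  by move: wl'; rewrite (leaf_unique dl dw elv ewv) eqxx.
have := gap F; rewrite sum_setT (bigID [in core]) /= => /(le_trans _) le.
have -> : \sum_(v in core) (\sum_(w in core) (e v w)%:R * f w) ^+ 2 / D v
   = \sum_(v in setT) (\sum_(w in setT) (e v w)%:R * F w) ^+ 2 / D v.
  rewrite sum_setT [RHS](bigID [in core]) /= [X in _ = _ + X]big1 ?addr0.
    by apply: eq_bigr => v vc; rewrite F_core.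
  by move=> v vc; rewrite F_out // expr0n mul0r.
apply: le; rewrite -[leLHS]addr0; apply: lerD.
  by apply: ler_sum => v vc; rewrite /F vc.
by apply: sumr_ge0 => v _; rewrite mulr_ge0 ?ler0n ?sqr_ge0.
Qed.

(** If the excess at [v] vanishes, so does [codeg core z v] for every other core vertex [z]. Hence a
    core neighbour [y] of [v] has no other core neighbour, and has degree 2. Its second neighbour
    [p] supports a leaf [l], and the minor at [y] and [l] fails. *)
Lemma core_excess_gt0 v : v \in core -> 0 < excess core v.
Proof.
move=> vc; rewrite lt0r excess_ge0 ?andbT //; last exact: gap_on_core.
apply/negP => /eqP hv.
have [y [yc eyv _]] : exists y, [/\ y \in core, e y v & e y v].
  apply: (@codeg_gt0 R n e core); move: hv; rewrite excessE.
  by have := D_gt0 (R := R) deg_gt0 v; lra.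
have only z : z \in core -> e y z -> z = v.
  move=> zc eyz; apply/eqP; apply: contraT => zv.
  have := codeg_minor gap_on_core zc vc zv; rewrite hv mulr0.
  have := codeg_ge (R := R) deg_gt0 yc eyz eyv; have := Dinv_gt0 (R := R) deg_gt0 y.
  by nra.
have hy := excess_ge0 gap_on_core yc.
have cy : codeg core y y <= (D v)^-1 + (D y - 1) * 0.
  apply: (codeg_diag_le2 e_sym eyv) => //; first by rewrite invr_ge0 ler0n.
  by move=> z zc eyz; rewrite (only z zc eyz) eqxx.
have dv2 := core_deg_ge2 vc; have dy2 := core_deg_ge2 yc.
have Dv2 := Dinv_le (R := R) deg_gt0 (isT : (0 < 2)%N) dv2.
have dy : deg e y = 2.
  apply/eqP; rewrite eqn_leq dy2 andbT -(ler_nat R).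
  by move: hy; rewrite excessE; lra.
have /eqP/cards2P [a [b [ab Ny]]] := dy.
have [p eyp pv] : exists2 p, e y p & p != v.
  have yE := nbrs_pairE Ny.
  have [va|va] := eqVneq v a; last by exists a; rewrite ?yE ?eqxx // eq_sym.
  by exists b; rewrite ?yE ?eqxx ?orbT // va eq_sym.
have pc : p \notin core by apply: contraNN pv => pc; rewrite (only p pc eyp).
have := core_nbr_not_leaf yc eyp; move: pc; rewrite inE negbK in_setU.
case/orP => [->//|]; rewrite inE => /exists_inP [l ll epl] _.
have dl : deg e l = 1%N by move: ll; rewrite inE => /eqP.
have elp : e l p by rewrite e_sym.
have epy : e p y by rewrite e_sym.
have yl : y != l by apply: contraTneq dy2 => ->; rewrite dl.
have := leaf_minor dl elp epy yl.
(* Now the excess of [y] is taken in the whole graph. With t = 1 / deg p it is at most 4 t, as [v]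
   has degree at least 2, so the leaf minor would read 16 t^2 <= (4 t - 1) 4 t. *)
have : codeg setT y y <= (D v)^-1 + (D y - 1) * (D p)^-1.
  apply: (codeg_diag_le2 e_sym eyv) => //; rewrite ?invr_ge0 ?ler0n //.
  move=> z _; rewrite (nbrs_pairE Ny) => zab zv.
  suff -> : z = p by [].
  move: eyp eyv zab; rewrite !(nbrs_pairE Ny).
  move=> /orP [] /eqP pE /orP [] /eqP vE /orP [] /eqP zE; subst=> //;
    by rewrite ?eqxx in pv zv.
have eT : excess setT y = 4 * codeg setT y y - D y by [].
have Dp := Dinv_gt0 (R := R) deg_gt0 p.
have := excess_ge0 gap (in_setT l); have := leaf_excess_le dl elp.
move: eT; rewrite dy => -> h1 h2 h3 h4.
have : 4 * codeg setT y y - 2 <= 4 * (D p)^-1 by lra.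
by nra.
Qed.

(** The leaf minors bound the degrees of [u] and [y] by 3. Degree 3 at [u] would require excess at
    least 16/3 at [y], but with only one leaf [y] has excess at most deg y + 2 <= 5. *)
Lemma support_pair_deg l u y z : deg e l = 1%N -> e l u -> e u y ->
  deg e z = 1%N -> e z y -> y != l -> u != z -> deg e u = 2.
Proof.
move=> dl elu euy dz ezy yl uz; have eyu : e y u by rewrite e_sym.
have du := support_deg_ge2 dl elu; have dy := support_deg_ge2 dz ezy.
have small p k : 0 <= k -> 16 * (D p)^-1 ^+ 2 <= (4 * (D p)^-1 - 1) * k ->
    (deg e p < 4)%N.
  move=> k0 mp; rewrite ltnNge; apply/negP => dp.
  have := Dinv_le (R := R) deg_gt0 (isT : (0 < 4)%N) dp.
  by have := Dinv_gt0 (R := R) deg_gt0 p; nra.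
have hu := excess_ge0 gap (in_setT u); have hy := excess_ge0 gap (in_setT y).
have minor := leaf_minor dl elu euy yl.
have dy4 := small _ _ hu (leaf_minor dz ezy eyu uz).
have du4 := small _ _ hy minor.
apply/eqP; rewrite eqn_leq du andbT leqNgt; apply/negP => du3.
have {}du3 : deg e u = 3 by lia.
have : codeg setT y y <= 1 + (D y - 1) * 2^-1.
  apply: (codeg_diag_le2 e_sym (u := z)) => //; first by rewrite e_sym.
  - by rewrite invr_ge0.
  - by rewrite dz invr1.
  move=> w _ eyw wz; apply: Dinv_le => //; rewrite ltn_neqAle deg_gt0 andbT.
  apply: contraNneq wz => /esym dw; apply/eqP; apply: (leaf_unique dz dw ezy).
  by rewrite e_sym.
have Dy : D y <= 3 by rewrite ler_nat; lia.
have eT : excess setT y = 4 * codeg setT y y - D y by [].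
move: minor; rewrite du3 eT; lra.
Qed.

(** Two adjacent supports [u], [y] have degree 2, so with their leaves they form the path l, u, y,
    z: a book with one page whose centres are the leaves [l] and [z]. *)
Lemma corona_shape : core = set0 ->
  exists b c, [/\ b != c, ~~ e b c, page_shape e b c & page_shape e c b].
Proof.
move=> core0.
have cover v : v \notin leaves -> exists2 l, deg e l = 1%N & e l v.
  move=> vl; have : v \notin core by rewrite core0 inE.
  rewrite inE negbK in_setU (negbTE vl) inE => /exists_inP [l ll evl].
  by exists l; [move: ll; rewrite inE => /eqP|rewrite e_sym].
have [l [u [dl elu]]] : exists l u, deg e l = 1%N /\ e l u.
  pose v0 : 'I_n := Ordinal (leq_trans (isT : (0 < 3)%N) n_ge3).
  have [v0l|/cover [l dl elv]] := boolP (v0 \in leaves); last by exists l, v0.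
  have := deg_gt0 v0; rewrite card_gt0 => /set0Pn [u]; rewrite inE => eu.
  by exists v0, u; split=> //; apply/eqP; move: v0l; rewrite inE.
have eul : e u l by rewrite e_sym.
have du := support_deg_ge2 dl elu.
have [y euy yl] : exists2 y, e u y & y != l.
  have : (0 < #|[set w | e u w] :\ l|)%N.
    by move: du; rewrite /deg (cardsD1 l) inE eul.
  by rewrite card_gt0 => /set0Pn [y]; rewrite !inE => /andP [yl euy]; exists y.
have eyu : e y u by rewrite e_sym.
have yleaf : y \notin leaves.
  rewrite inE; apply/negP => /eqP dy; move: yl.
  by rewrite (leaf_unique dl dy elu eyu) eqxx.
have [z dz ezy] := cover y yleaf.
have eyz : e y z by rewrite e_sym.
have uz : u != z by apply: contraTneq du => ->; rewrite dz.
have du2 := support_pair_deg dl elu euy dz ezy yl uz.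
have dy2 := support_pair_deg dz ezy eyu dl elu uz yl.
have lz : l != z.
  apply: contraTneq ezy => <-; rewrite (leaf_nbr dl elu).
  by apply: contraTneq euy => ->.
exists l, z; split=> //.
- by rewrite (leaf_nbr dl elu) eq_sym.
- move=> x; rewrite (leaf_nbr dl elu) => /eqP ->; exists y => //.
  by apply: nbrs_of_deg2 => //; rewrite eq_sym.
- move=> x; rewrite (leaf_nbr dz ezy) => /eqP ->; exists u => //.
  by apply: nbrs_of_deg2 => //; rewrite eq_sym.
Qed.

Lemma gap_shape : (exists b, page_shape e b b) \/
  (exists b c, [/\ b != c, ~~ e b c, page_shape e b c & page_shape e c b]).
Proof.
have [/corona_shape ?|/set0Pn [v vc]] := eqVneq core set0; first by right.
exact: (positive_shape e_sym e_irr deg_gt0 gap_on_core core_deg_ge2 core_excess_gt0 vc).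
Qed.

End Leaves.

(** * Isomorphisms with petals and books *)

(** The explicit maps below start from the model graph, whereas [graph_iso] asks for a map into
    it. *)
Lemma graph_iso_inverse (T T' : finType) (e : rel T) (e' : rel T') (g : T' -> T) :
  injective g -> (forall v, exists p, g p = v) ->
  (forall p q, e (g p) (g q) = e' p q) -> graph_iso e e'.
Proof.
move=> g_inj g_surj g_adj.
have gsurj v : exists p, g p == v by have [p <-] := g_surj v; exists p.
pose f v := xchoose (gsurj v).
have fK : cancel f g by move=> v; apply/eqP; exact: (xchooseP (gsurj v)).
have gK : cancel g f by move=> p; apply: g_inj; rewrite fK.
by exists f; split=> [|a b]; [exists g|rewrite -g_adj !fK].
Qed.

Section Shapes.
Context {n : nat} {e : rel 'I_n}.
Context (e_sym : forall u v, e u v = e v u) (e_irr : forall v, ~~ e v v).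
Context (conn : connected_graph e) (deg_gt0 : forall v, (0 < deg e v)%N).
Implicit Types (b c x y : 'I_n).

Lemma page_partner b c : page_shape e b c ->
  exists t : 'I_n -> 'I_n, forall x, e b x ->
    e c (t x) /\ forall y, e x y = (y == b) || (y == t x).
Proof.
move=> page.
(* The default [x] is never reached on neighbours of [b]. *)
exists (fun x => odflt x [pick z | e c z && ([set w | e x w] == [set b; z])]).
move=> x ebx; case: pickP => [z /andP [ecz /eqP Nx]|none] /=.
  by split=> //; exact: nbrs_pairE.
by have [z ecz Nx] := page x ebx; have := none z; rewrite ecz Nx eqxx.
Qed.

Lemma nbr_exists b : exists x, e b x.
Proof.
by have := deg_gt0 b; rewrite card_gt0 => /set0Pn [x]; rewrite inE; exists x.
Qed.

(** On the neighbours of [b] the partner map [t] is an involution without fixed points, and its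
    orbits are the petals. *)
Lemma petal_of_page b : page_shape e b b ->
  exists m : nat, (1 <= m)%N /\ graph_iso e (@petal_adj m).
Proof.
move=> /page_partner [t tP].
have nb x : e b x -> (x == b) = false by apply: contraTF => /eqP ->.
have tnb x : e b x -> e b (t x) by move=> /tP [].
have adjE x y : e b x -> e x y = (y == b) || (y == t x) by move=> /tP [].
have tx x : e b x -> x != t x.
  move=> ebx; have : e x (t x) by rewrite adjE ?eqxx ?orbT.
  by apply: contraTneq => <-.
have ttx x : e b x -> t (t x) = x.
  move=> ebx; have := adjE _ x (tnb x ebx).
  by rewrite e_sym adjE // eqxx orbT nb //= => /esym/eqP.
(* The order of the vertices selects one from each pair, so [S] indexes the petals. *)
pose S := [set x | e b x & (x < t x)%N].
have SP (i : 'I_#|S|) : e b (enum_val i) && (enum_val i < t (enum_val i))%N.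
  by have := enum_valP i; rewrite inE.
have Sb i := proj1 (andP (SP i)); have Slt i := proj2 (andP (SP i)).
pose g (p : option ('I_#|S| + 'I_#|S|)) := match p with
  | None => b | Some (inl i) => enum_val i | Some (inr i) => t (enum_val i) end.
have nbS x : e b x -> exists i : 'I_#|S|, (enum_val i == x) || (enum_val i == t x).
  move=> ebx; case: (ltngtP x (t x)) => [lt|gt|eq].
  - have xS : x \in S by rewrite inE ebx.
    by exists (enum_rank_in xS x); rewrite enum_rankK_in // eqxx.
  - have xS : t x \in S by rewrite inE tnb //= ttx.
    by exists (enum_rank_in xS (t x)); rewrite enum_rankK_in // eqxx orbT.
  - by have := tx x ebx; rewrite -val_eqE /= eq eqxx.
have Seq (i j : 'I_#|S|) : (enum_val i == enum_val j) = (i == j).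
  by rewrite (inj_eq enum_val_inj).
have Steq (i j : 'I_#|S|) : (t (enum_val i) == t (enum_val j)) = (i == j).
  rewrite -Seq; apply/eqP/eqP => [|-> //].
  by move/(congr1 t); rewrite !ttx.
have Sdisj (i j : 'I_#|S|) : (enum_val i == t (enum_val j)) = false.
  apply/eqP => ij; have := Slt i; have := Slt j; rewrite -ij.
  have -> : t (enum_val i) = enum_val j by rewrite ij ttx.
  by move/ltn_trans => /[apply]; rewrite ltnn.
exists #|S|; split.
  have [x ebx] := nbr_exists b; have [i _] := nbS x ebx.
  exact: leq_ltn_trans (leq0n i) (ltn_ord i).
apply: (@graph_iso_inverse _ _ _ _ g).
- have Stb i := nb _ (tnb _ (Sb i)); have Snb i := nb _ (Sb i).
  move=> [[i|i]|] [[j|j]|] //= /eqP; rewrite ?Seq ?Steq ?Sdisj ?Stb ?Snb //;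
    try by move=> /eqP ->.
  + by rewrite eq_sym Sdisj.
  + by rewrite eq_sym Snb.
  + by rewrite eq_sym Stb.
- have full : b |: [set x | e b x] = setT.
    apply: (@connected_closed _ e _ b) => //; first by rewrite !inE eqxx.
    move=> u v; rewrite !inE => /orP [/eqP -> ->|ebu]; first by rewrite orbT.
    by rewrite adjE // => /orP [->|/eqP ->] //; rewrite tnb ?orbT.
  move=> v; have : v \in b |: [set x | e b x] by rewrite full inE.
  rewrite !inE => /orP [/eqP ->|ebv]; first by exists None.
  have [i /orP [] /eqP iE] := nbS v ebv; first by exists (Some (inl i)).
  by exists (Some (inr i)); rewrite /= iE ttx.
- have Stb i := nb _ (tnb _ (Sb i)); have Snb i := nb _ (Sb i).
  move=> [[i|i]|] [[j|j]|] //=; rewrite ?Sb ?(tnb _ (Sb _)) //.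
  + by rewrite adjE // Snb Sdisj.
  + by rewrite adjE // Stb Steq eq_sym.
  + by rewrite e_sym Sb.
  + by rewrite e_sym adjE // Stb Steq.
  + by rewrite adjE ?tnb // Stb ttx // eq_sym Sdisj.
  + by rewrite e_sym tnb.
  + by apply/negbTE.
Qed.

(** The partner maps [t] and [s] are mutually inverse between the neighbours of [b] and those of
    [c], so the neighbours of [b] index the pages. *)
Lemma book_of_pages b c : b != c -> ~~ e b c -> page_shape e b c ->
  page_shape e c b -> exists m : nat, (1 <= m)%N /\ graph_iso e (@book_adj m).
Proof.
move=> bc nbc /page_partner [t tP] /page_partner [s sP].
have ncb : ~~ e c b by rewrite e_sym.
have tc x : e b x -> e c (t x) by move=> /tP [].
have sb x : e c x -> e b (s x) by move=> /sP [].
have adjb x y : e b x -> e x y = (y == b) || (y == t x) by move=> /tP [].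
have adjc x y : e c x -> e x y = (y == c) || (y == s x) by move=> /sP [].
have bb x : e b x -> (x == b) = false by apply: contraTF => /eqP ->.
have bc' x : e b x -> (x == c) = false by apply: contraTF => /eqP ->.
have cc x : e c x -> (x == c) = false by apply: contraTF => /eqP ->.
have cb x : e c x -> (x == b) = false by apply: contraTF => /eqP ->.
(* A common neighbour of [b] and [c] would have [c] as its partner, making [c] adjacent to
   itself. *)
have disj x y : e b x -> e c y -> (x == y) = false.
  move=> ebx; apply: contraTF => /eqP <-; rewrite e_sym adjb // eq_sym (negbTE bc) /=.
  by apply: contraTN (tc x ebx) => /eqP <-.
have stK x : e b x -> s (t x) = x.
  move=> ebx; have := adjc _ x (tc x ebx).
  by rewrite e_sym adjb // eqxx orbT bc' //= => /esym/eqP.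
have tsK x : e c x -> t (s x) = x.
  move=> ecx; have := adjb _ x (sb x ecx).
  by rewrite e_sym adjc // eqxx orbT cb //= => /esym/eqP.
pose S := [set x | e b x].
have Sb (i : 'I_#|S|) : e b (enum_val i) by have := enum_valP i; rewrite inE.
have Stc (i : 'I_#|S|) := tc _ (Sb i).
pose g (p : bool + ('I_#|S| + 'I_#|S|)) := match p with
  | inl true => b | inl false => c
  | inr (inl i) => enum_val i | inr (inr i) => t (enum_val i) end.
have nbS x : e b x -> exists i : 'I_#|S|, enum_val i = x.
  move=> ebx; have xS : x \in S by rewrite inE.
  by exists (enum_rank_in xS x); rewrite enum_rankK_in.
have Seq (i j : 'I_#|S|) : (enum_val i == enum_val j) = (i == j).
  by rewrite (inj_eq enum_val_inj).
have Steq (i j : 'I_#|S|) : (t (enum_val i) == t (enum_val j)) = (i == j).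
  rewrite -Seq; apply/eqP/eqP => [|-> //].
  by move/(congr1 s); rewrite !stK.
have Sdisj (i j : 'I_#|S|) := disj _ _ (Sb i) (Stc j).
have Sdisj' (i j : 'I_#|S|) : (t (enum_val j) == enum_val i) = false.
  by rewrite eq_sym Sdisj.
exists #|S|; split.
  have [x ebx] := nbr_exists b; have [i _] := nbS x ebx.
  exact: leq_ltn_trans (leq0n i) (ltn_ord i).
have eqs := (Seq, Steq, Sdisj, Sdisj', fun i => bb _ (Sb i), fun i => bc' _ (Sb i),
  fun i => cb _ (Stc i), fun i => cc _ (Stc i)).
apply: (@graph_iso_inverse _ _ _ _ g).
- move=> [[]|[i|i]] [[]|[j|j]] //= /eqP; rewrite ?eqs ?(negbTE bc) //;
    try (by move=> /eqP ->); by rewrite eq_sym ?eqs // (negbTE bc).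
- have full : [set x | [|| x == b, x == c, e b x | e c x]] = setT.
    apply: (@connected_closed _ e _ b) => //; first by rewrite !inE eqxx.
    move=> u v; rewrite !inE => /or4P [/eqP ->|/eqP ->|ebu|ecu].
    + by move=> ->; rewrite !orbT.
    + by move=> ->; rewrite !orbT.
    + by rewrite adjb // => /orP [] /eqP ->; rewrite ?eqxx // tc ?orbT.
    + by rewrite adjc // => /orP [] /eqP ->; rewrite ?eqxx ?orbT // sb ?orbT.
  move=> v; have : v \in [set x | [|| x == b, x == c, e b x | e c x]] by rewrite full inE.
  rewrite inE => /or4P [/eqP ->|/eqP ->|/nbS [i <-]|ecv].
  + by exists (inl true).
  + by exists (inl false).
  + by exists (inr (inl i)).
  + have [i iE] := nbS _ (sb v ecv).
    by exists (inr (inr i)); rewrite /= iE tsK.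
- have nbt (i : 'I_#|S|) : e b (t (enum_val i)) = false.
    by apply/negbTE/negP => /disj /(_ (Stc i)); rewrite eqxx.
  have ncs (i : 'I_#|S|) : e c (enum_val i) = false.
    by apply/negbTE/negP => /(disj _ _ (Sb i)); rewrite eqxx.
  move=> [[]|[i|i]] [[]|[j|j]] //=.
  + exact/negbTE.
  + exact/negbTE.
  + exact: Sb.
  + exact/negbTE.
  + exact/negbTE.
  + exact: Stc.
  + by rewrite e_sym Sb.
  + by rewrite e_sym ncs.
  + by rewrite adjb // !eqs.
  + by rewrite adjb // !eqs eq_sym.
  + by rewrite e_sym nbt.
  + by rewrite e_sym Stc.
  + by rewrite e_sym adjb // !eqs.
  + by rewrite adjc // !eqs stK // Sdisj'.
Qed.

End Shapes.

(** * Eigenvalues of petals and books *)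

Lemma sum_option (V : nmodType) (T : finType) (F : option T -> V) :
  \sum_x F x = F None + \sum_x F (Some x).
Proof.
rewrite (bigD1 None) //=; congr (_ + _).
rewrite (reindex_omap Some id) /=; first by apply: eq_bigl => x; rewrite eqxx.
by case.
Qed.

Lemma sum_delta (R : pzSemiRingType) (T : finType) (i : T) (F : T -> R) :
  \sum_j (i == j)%:R * F j = F i.
Proof.
rewrite (bigD1 i) //= eqxx mul1r big1 ?addr0 // => j ji.
by rewrite eq_sym (negbTE ji) mul0r.
Qed.

(** Eigenfunctions of the random walk D^-1 A, with denominators cleared. Degrees are written as
    sums, so that the model graphs on other finite types are included. *)
Definition walk_eigen (R : realType) (T : finType) (e : rel T) (mu : R) (u : T -> R) :=
  (exists a, u a != 0) /\
  forall b, \sum_a (e b a)%:R * u a = mu * (\sum_a (e b a)%:R) * u b.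

Lemma natr_deg (R : realType) n (e : rel 'I_n) v :
  (deg e v)%:R = \sum_w (e v w)%:R :> R.
Proof.
rewrite /deg -sum1_card natr_sum big_mkcond /=; apply: eq_bigr => w _.
by rewrite inE; case: (e v w).
Qed.

(** The degree matrix times the Laplacian is symmetric, so weighting an eigenfunction by degrees
    gives a row eigenvector. *)
Lemma eigenvalue_walk (R : realType) n (e : rel 'I_n) (mu : R) :
  (forall u v, e u v = e v u) -> (forall v, (0 < deg e v)%N) ->
  eigenvalue (norm_laplacian R e) (1 - mu) <-> exists u, walk_eigen e mu u.
Proof.
move=> e_sym deg_gt0.
have D0 i : (deg e i)%:R != 0 :> R by rewrite pnatr_eq0 -lt0n.
have LE (u : 'I_n -> R) j :
    ((\row_i ((deg e i)%:R * u i)) *m norm_laplacian R e) 0 j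
    = (deg e j)%:R * u j - \sum_i (e j i)%:R * u i.
  rewrite mxE; under eq_bigr do rewrite !mxE mulrBr.
  rewrite sumrB; congr (_ - _).
    rewrite (bigD1 j) //= eqxx mulr1 big1 ?addr0 // => i /negbTE ->.
    by rewrite mulr0.
  by apply: eq_bigr => i _; rewrite e_sym; field; exact: D0.
split=> [/eigenvalueP [v vL v0]|[u [[a ua] uE]]].
  pose u i := v 0 i / (deg e i)%:R.
  have vE : v = \row_i ((deg e i)%:R * u i).
    by apply/rowP => i; rewrite mxE /u mulrC divfK.
  exists u; split.
    have [i vi] := rV0Pn v v0.
    by exists i; rewrite mulf_neq0 // invr_neq0.
  move=> j; move/rowP: vL => /(_ j); rewrite {1}vE LE mxE {1}vE mxE -natr_deg.
  by lra.
apply/eigenvalueP; exists (\row_i ((deg e i)%:R * u i)).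
  by apply/rowP => j; rewrite LE uE !mxE -natr_deg; ring.
by apply/rV0Pn; exists a; rewrite mxE mulf_neq0.
Qed.

Lemma walk_eigen_pull (R : realType) (T T' : finType) (e : rel T) (e' : rel T')
    (f : T -> T') (mu : R) u :
  bijective f -> (forall a b, e' (f a) (f b) = e a b) ->
  walk_eigen e' mu u -> walk_eigen e mu (u \o f).
Proof.
move=> [g fK gK] fe [[a ua] uE]; split; first by exists (g a); rewrite /= gK.
have f_on : {on predT, bijective f} by exists g => x _.
move=> b; have := uE (f b); rewrite 2!(reindex f f_on) /=.
rewrite (eq_bigr (fun x => (e b x)%:R * u (f x))); last by move=> x _; rewrite fe.
by rewrite [X in _ = _ * X * _](eq_bigr (fun x => (e b x)%:R)); last by move=> x _; rewrite fe.
Qed.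

Lemma walk_eigen_iso (R : realType) (T T' : finType) (e : rel T) (e' : rel T') (mu : R) :
  graph_iso e e' ->
  (exists u, walk_eigen e mu u) <-> (exists u, walk_eigen e' mu u).
Proof.
move=> [f [f_bij fe]]; have [g fK gK] := f_bij.
split=> [[u uE]|[u uE]]; last by exists (u \o f); exact: walk_eigen_pull uE.
exists (u \o g); apply: walk_eigen_pull uE; first by exists f.
by move=> a b; rewrite -fe !gK.
Qed.

Lemma sum0mul (R : pzSemiRingType) (T : finType) (F : T -> R) : \sum_i 0 * F i = 0.
Proof. by rewrite big1 // => i _; rewrite mul0r. Qed.

Lemma petal_walk (R : realType) m (mu : R) (u : option ('I_m + 'I_m) -> R) :
  (forall b, \sum_a (petal_adj b a)%:R * u a = mu * (\sum_a (petal_adj b a)%:R) * u b) <->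
  [/\ \sum_i u (Some (inl i)) + \sum_i u (Some (inr i)) = mu * (m%:R + m%:R) * u None,
      forall i, u None + u (Some (inr i)) = mu * 2 * u (Some (inl i)) &
      forall i, u None + u (Some (inl i)) = mu * 2 * u (Some (inr i))].
Proof.
have sumE b (w : option ('I_m + 'I_m) -> R) : \sum_a (petal_adj b a)%:R * w a =
  match b with
  | None => \sum_i w (Some (inl i)) + \sum_i w (Some (inr i))
  | Some (inl i) => w None + w (Some (inr i))
  | Some (inr i) => w None + w (Some (inl i)) end.
  rewrite sum_option big_sumType /=; case: b => [[i|i]|] /=.
  - by rewrite mul1r sum0mul add0r sum_delta.
  - by rewrite mul1r sum0mul addr0 sum_delta.
  - by rewrite mul0r add0r; congr (_ + _); apply: eq_bigr => i _; rewrite mul1r.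
have degE (b : option ('I_m + 'I_m)) : \sum_a (petal_adj b a)%:R =
   match b with None => m%:R + m%:R | Some _ => 2 end :> R.
  transitivity (\sum_a (petal_adj b a)%:R * 1 : R).
    by apply: eq_bigr => a _; rewrite mulr1.
  by rewrite (sumE b (fun=> 1)); case: b => [[i|i]|] //; rewrite !sumr_const card_ord.
split=> [uE|[u0 u1 u2] b].
  by split=> [|i|i]; [have := uE None|have := uE (Some (inl i))|have := uE (Some (inr i))];
    rewrite sumE degE.
by rewrite sumE degE; case: b => [[i|i]|].
Qed.

Lemma book_walk (R : realType) m (mu : R) (u : bool + ('I_m + 'I_m) -> R) :
  (forall b, \sum_a (book_adj b a)%:R * u a = mu * (\sum_a (book_adj b a)%:R) * u b) <->
  [/\ \sum_i u (inr (inl i)) = mu * m%:R * u (inl true) /\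
      \sum_i u (inr (inr i)) = mu * m%:R * u (inl false),
      forall i, u (inl true) + u (inr (inr i)) = mu * 2 * u (inr (inl i)) &
      forall i, u (inl false) + u (inr (inl i)) = mu * 2 * u (inr (inr i))].
Proof.
have sumE b (w : bool + ('I_m + 'I_m) -> R) : \sum_a (book_adj b a)%:R * w a =
  match b with
  | inl true => \sum_i w (inr (inl i))
  | inl false => \sum_i w (inr (inr i))
  | inr (inl i) => w (inl true) + w (inr (inr i))
  | inr (inr i) => w (inl false) + w (inr (inl i)) end.
  rewrite !big_sumType /= big_bool /=; case: b => [[]|[i|i]] /=;
    rewrite ?mul0r ?mul1r ?sum0mul ?sum_delta ?add0r ?addr0 //;
    by apply: eq_bigr => i _; rewrite mul1r.
have degE (b : bool + ('I_m + 'I_m)) : \sum_a (book_adj b a)%:R =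
   match b with inl _ => m%:R | inr _ => 2 end :> R.
  transitivity (\sum_a (book_adj b a)%:R * 1 : R).
    by apply: eq_bigr => a _; rewrite mulr1.
  by rewrite (sumE b (fun=> 1)); case: b => [[]|[i|i]] //; rewrite !sumr_const card_ord.
split=> [uE|[[u0 u0'] u1 u2] b].
  split=> [|i|i]; last 2 first.
  - by have := uE (inr (inl i)); rewrite sumE degE.
  - by have := uE (inr (inr i)); rewrite sumE degE.
  by split; [have := uE (inl true)|have := uE (inl false)]; rewrite sumE degE.
by rewrite sumE degE; case: b => [[]|[i|i]].
Qed.

(** With the value 1 on all outer vertices, the equation there reads c + 1 = -1, so the centre gets
    -2. Books reuse these values at both centres. *)
Lemma petal_walk_half (R : realType) m :
  (1 <= m)%N -> exists u, walk_eigen (@petal_adj m) (- (1 / 2) : R) u.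
Proof.
move=> m1; exists (fun a => if a is None then -2 else 1); split.
  by exists None; rewrite oppr_eq0 pnatr_eq0.
apply/petal_walk; split=> [|i|i]; try lra.
by rewrite !sumr_const card_ord; lra.
Qed.

Lemma book_walk_half (R : realType) m :
  (1 <= m)%N -> exists u, walk_eigen (@book_adj m) (- (1 / 2) : R) u.
Proof.
move=> m1; exists (fun a => if a is inl _ then -2 else 1); split.
  by exists (inl true); rewrite oppr_eq0 pnatr_eq0.
apply/book_walk; split=> [|i|i]; try lra.
by rewrite !sumr_const card_ord; split; lra.
Qed.

(** Once the centres carry 0, each pair of outer vertices satisfies this system, whose determinant 1
    - 4 mu^2 is nonzero. *)
Lemma mutual_walk_eq0 (R : realFieldType) (mu v w : R) :
  -(1 / 2) < mu -> mu < 1 / 2 -> w = mu * 2 * v -> v = mu * 2 * w -> v = 0.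
Proof.
move=> mu1 mu2 wE vE; have c1 : (1 - 2 * mu) * (1 + 2 * mu) != 0.
  by apply: mulf_neq0; apply/eqP; lra.
have /eqP : (1 - 2 * mu) * (1 + 2 * mu) * v = 0.
  have -> : (1 - 2 * mu) * (1 + 2 * mu) * v = v - mu * 2 * (mu * 2 * v) by ring.
  by rewrite -wE -vE subrr.
by rewrite mulf_eq0 (negbTE c1) => /eqP.
Qed.

Lemma sum_walk (R : realType) m (x k : R) (v w : 'I_m -> R) :
  (forall i, x + w i = k * v i) -> m%:R * x + \sum_i w i = k * \sum_i v i.
Proof.
move=> vw; rewrite mulr_sumr -(eq_bigr _ (fun i _ => vw i)) big_split /=.
by rewrite sumr_const card_ord mulr_natl.
Qed.

(** Summing the outer equations leaves a system in the centre value and the outer sum that is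
    singular only for [mu] equal to 1 or -1/2. So for smaller [mu] the centre value is 0. *)
Lemma petal_walk_ge (R : realType) m (mu : R) u : (1 <= m)%N ->
  walk_eigen (@petal_adj m) mu u -> 1 / 2 <= `|mu|.
Proof.
move=> m1 [[a ua] /petal_walk [u0 u1 u2]].
rewrite leNgt; apply/negP; rewrite ltr_norml => /andP [mu1 mu2].
have sum1 := sum_walk u1; have sum2 := sum_walk u2.
have c0 : 2 * m%:R * ((1 - mu) * (1 + 2 * mu)) != 0.
  by rewrite !mulf_neq0 ?pnatr_eq0 -?lt0n //; apply/eqP; lra.
have /eqP : 2 * m%:R * ((1 - mu) * (1 + 2 * mu)) * u None = 0.
  move: sum1 sum2 u0; set A := \sum_i _; set B := \sum_i _ => sum1 sum2 u0.
  have sumAB : 2 * (m%:R * u None) + (B + A) = mu * 2 * (B + A).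
    by rewrite mulrDr -sum1 -sum2; ring.
  by rewrite u0 in sumAB; lra.
rewrite mulf_eq0 (negbTE c0) => /eqP x0.
have z i : u (Some (inl i)) = 0 /\ u (Some (inr i)) = 0.
  have := u1 i; have := u2 i; rewrite x0 !add0r => h1 h2.
  by split; [exact: mutual_walk_eq0 h2 h1|exact: mutual_walk_eq0 h1 h2].
move/eqP: ua; apply.
by case: a => [[i|i]|] //; case: (z i).
Qed.

(** The summed equations give a symmetric system for the two centres with determinant (1 - 2 mu^2)^2
    - mu^2, whose roots are 1/2, -1/2, 1 and -1. *)
Lemma book_walk_ge (R : realType) m (mu : R) u : (1 <= m)%N ->
  walk_eigen (@book_adj m) mu u -> 1 / 2 <= `|mu|.
Proof.
move=> m1 [[a ua] /book_walk [[u0 u0'] u1 u2]].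
rewrite leNgt; apply/negP; rewrite ltr_norml => /andP [mu1 mu2].
have sum1 := sum_walk u1; have sum2 := sum_walk u2.
rewrite u0 u0' in sum1 sum2.
have m0 : m%:R != 0 :> R by rewrite pnatr_eq0 -lt0n.
have eq1 : u (inl true) * (1 - 2 * mu ^+ 2) = - mu * u (inl false).
  by apply: (mulfI m0); lra.
have eq2 : u (inl false) * (1 - 2 * mu ^+ 2) = - mu * u (inl true).
  by apply: (mulfI m0); lra.
have c0 : (1 - 2 * mu) * (1 + mu) * ((1 + 2 * mu) * (1 - mu)) != 0.
  by rewrite !mulf_neq0 //; apply/eqP; lra.
have solve x y : x * (1 - 2 * mu ^+ 2) = - mu * y -> y * (1 - 2 * mu ^+ 2) = - mu * x ->
    x = 0.
  move=> xE yE.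
  have /eqP : (1 - 2 * mu) * (1 + mu) * ((1 + 2 * mu) * (1 - mu)) * x = 0.
    have : x * (1 - 2 * mu ^+ 2) * (1 - 2 * mu ^+ 2) = mu ^+ 2 * x.
      by rewrite xE -mulrA yE; ring.
    by move=> h; rewrite -[RHS](subrr (mu ^+ 2 * x)) -{1}h; ring.
  by rewrite mulf_eq0 (negbTE c0) => /eqP.
have x0 := solve _ _ eq1 eq2; have y0 := solve _ _ eq2 eq1.
have z i : u (inr (inl i)) = 0 /\ u (inr (inr i)) = 0.
  have := u1 i; have := u2 i; rewrite x0 y0 !add0r => h1 h2.
  by split; [exact: mutual_walk_eq0 h2 h1|exact: mutual_walk_eq0 h1 h2].
move/eqP: ua; apply.
by case: a => [[]|[i|i]] //; case: (z i).
Qed.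

(** * Existence of the minimum and the equality case *)

Lemma exists_eps (R : realType) n (e : rel 'I_n) :
  (0 < n)%N -> (forall u v, e u v = e v u) -> (forall v, (0 < deg e v)%N) ->
  exists eps : R, is_eps e eps.
Proof.
move=> n0 e_sym deg_gt0.
pose p := char_poly (norm_laplacian R e).
have p0 : p != 0 by rewrite monic_neq0 ?char_poly_monic.
have rootE l : (l \in rootsR p) = eigenvalue (norm_laplacian R e) l.
  by rewrite eigenvalue_root_char; have := roots_on_rootsR p0 l; rewrite inE.
have one : exists l, l \in rootsR p.
  (* Constant functions give the eigenvalue 0, written [1 - 1] to match [eigenvalue_walk] at
     [mu = 1]. *)
  exists (1 - 1); rewrite rootE; apply/(eigenvalue_walk _ e_sym deg_gt0).
  exists (fun=> 1); split; first by exists (Ordinal n0); rewrite oner_eq0.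
  by move=> b; rewrite mul1r mulr1; apply: eq_bigr => i _; rewrite mulr1.
have argmin (s : seq R) : (exists l, l \in s) ->
    exists2 l, l \in s & forall l', l' \in s -> `|1 - l| <= `|1 - l'|.
  elim: s => [[l //]|l s IHs _].
  have [->|s0] := eqVneq s [::].
    by exists l; rewrite ?inE ?eqxx // => l'; rewrite inE => /eqP ->.
  have [|k ks kmin] := IHs.
    by case: s s0 {IHs} => // k s _; exists k; rewrite inE eqxx.
  have [lk|kl] := leP `|1 - l| `|1 - k|.
    exists l; rewrite ?inE ?eqxx // => l'; rewrite inE => /orP [/eqP -> //|/kmin].
    exact: le_trans.
  exists k; rewrite ?inE ?ks ?orbT // => l'; rewrite inE => /orP [/eqP ->|/kmin //].
  exact: ltW.
have [l ls lmin] := argmin _ one; exists `|1 - l|; split; first by exists l; rewrite -?rootE.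
by move=> l'; rewrite -rootE; exact: lmin.
Qed.

Theorem mainTheorem1 (R : realType) (n : nat) (e : rel 'I_n) :
  simple_graph e -> connected_graph e -> (3 <= n)%N ->
  (exists eps : R, is_eps e eps) /\
  (forall eps : R, is_eps e eps ->
     eps <= 1 / 2 /\
     (eps = 1 / 2 <->
        (exists m : nat, (1 <= m)%N /\ graph_iso e (@petal_adj m)) \/
        (exists m : nat, (1 <= m)%N /\ graph_iso e (@book_adj m)))).
Proof.
move=> [e_sym e_irr] conn n_ge3.
have deg_gt0 := connected_deg_gt0 conn n_ge3.
split; first exact: exists_eps (leq_trans (isT : (0 < 3)%N) n_ge3) e_sym deg_gt0.
move=> eps [[l0 l0eig ->] epsmin].
have walk l : eigenvalue (norm_laplacian R e) l <-> exists u, walk_eigen e (1 - l) u.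
  by rewrite -{1}[l](subKr 1); exact: eigenvalue_walk.
have shape : 1 / 2 <= `|1 - l0| ->
    (exists m : nat, (1 <= m)%N /\ graph_iso e (@petal_adj m)) \/
    (exists m : nat, (1 <= m)%N /\ graph_iso e (@book_adj m)).
  move=> le_half; have gap : gap_on R e setT.
    by apply: gap_on_setT => // l /epsmin; exact: le_trans.
  have [[b]|[b [c [bc nbc]]]] := gap_shape e_sym e_irr conn n_ge3 gap.
    by left; apply: petal_of_page p.
  by right; apply: book_of_pages nbc p p0.
have attained : (exists m : nat, (1 <= m)%N /\ graph_iso e (@petal_adj m)) \/
    (exists m : nat, (1 <= m)%N /\ graph_iso e (@book_adj m)) ->
    `|1 - l0| = 1 / 2.
  move=> iso; apply/eqP; rewrite eq_le; apply/andP; split.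
    have : eigenvalue (norm_laplacian R e) (1 - - (1 / 2)).
      apply/(eigenvalue_walk _ e_sym deg_gt0).
      case: iso => [[m [m1 /walk_eigen_iso ->]]|[m [m1 /walk_eigen_iso ->]]].
        exact: petal_walk_half.
      exact: book_walk_half.
    by move/epsmin; rewrite subKr normrN [`|1 / 2|]ger0_norm // divr_ge0.
  case: iso => [[m [m1 iso]]|[m [m1 iso]]].
    have [u] := proj1 (walk_eigen_iso _ iso) (proj1 (walk l0) l0eig).
    exact: petal_walk_ge.
  have [u] := proj1 (walk_eigen_iso _ iso) (proj1 (walk l0) l0eig).
  exact: book_walk_ge.
(* A value above 1/2 would also yield a petal or book graph by [shape], and there the value is
   exactly 1/2. *)
have le_half : `|1 - l0| <= 1 / 2.
  rewrite leNgt; apply/negP => lt_half.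
  by have := lt_half; rewrite (attained (shape (ltW lt_half))) ltxx.
by split=> //; split=> [l0E|//]; apply: shape; rewrite l0E.
Qed.
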